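(* Let $r\ge1$ and let $\varphi_r$ be the smallest solution $\theta\in[0,1/(r+1)]$ of the equation $\theta\bigl(1-\frac1{r+1}-(r-1)\theta\bigr)^{r-1}=h(r,\theta)$. Then $h(r,\theta)=f(r+1,\theta)$ is constant for $\theta\in[0,\varphi_r]$.
   Context: Preference orders: for a total order $<$ on $[m]$ and $k\in[m]$, ${\rm rpos}_<(k)=\frac1m|\{j\in[m]:j\le k\text{ in }<\}|$. An $(s,m)$-preference order is $P=(<_1,\dots,<_s)$, total orders on $[m]$; $x\in P$ means $x=({\rm rpos}_{<_1}(k),\dots,{\rm rpos}_{<_s}(k))$ for some $k$. For $x\in[0,1]^s$, $i_x=\min\{i:x_i=\max_jx_j\}$. For $0\le\theta\le1/s$: $f_P(\theta)=\max\{\prod_{i\ne i_x}x_i:x\in P,\ x\in[\theta,1]^s\}$, $f(s,\theta,m)=\min_Pf_P(\theta)$, $f(s,\theta)=\inf_mf(s,\theta,m)$. Covers: an $r$-cover is an $r$-uniform hypergraph $Q$ with $V(Q)\subset[0,1]$ whose edges form a perfect matching of $V(Q)$; $h(Q)=\max_{e\in E(Q)}\prod_{y\in e}y$. For $\theta\in[0,1/(r+1))$, an $(r,\theta,n)$-cover has $V(Q)=\{\theta+(\frac1{r+1}-\theta)\frac jn:j\in[rn]\}$; $h(r,\theta,n)=\min h(Q)$ over $(r,\theta,n)$-covers, $h(r,\theta)=\inf_nh(r,\theta,n)$, and $h(r,1/(r+1))=\lim_{\theta\to(1/(r+1))^-}h(r,\theta)=(r+1)^{-r}$. *)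

(* Defs.v *)
From HB Require Import structures.
From mathcomp Require Import all_boot all_order all_algebra finmap.
From mathcomp Require Import all_classical all_reals all_analysis.

Set Implicit Arguments.
Unset Strict Implicit.
Unset Printing Implicit Defensive.

Import Order.TTheory GRing.Theory Num.Theory.
Import numFieldNormedType.Exports.

Local Open Scope classical_set_scope.
Local Open Scope ring_scope.

Section PreferenceOrders.
Context {R : realType}.

(* An order on [m] is given by its non-strict relation on 'I_m (element k of
   [m] being represented by k - 1); reflexivity follows from totality. *)
Definition total_order_rel (m : nat) (le : rel 'I_m) : Prop :=
  [/\ total le, antisymmetric le & transitive le].

Definition rpos (m : nat) (le : rel 'I_m) (k : 'I_m) : R :=
  #|[pred j | le j k]|%:R / m%:R.

Definition preference_order (s m : nat) (P : 'I_s -> rel 'I_m) : Prop :=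
  forall i, total_order_rel (P i).

Definition ppoint (s m : nat) (P : 'I_s -> rel 'I_m) (k : 'I_m) : 'I_s -> R :=
  fun i => rpos (P i) k.

(* [is_imax x i] says that i = i_x, the least index of a maximal coordinate. *)
Definition is_imax (s : nat) (x : 'I_s -> R) (i : 'I_s) : bool :=
  [forall j, x j <= x i] && [forall j : 'I_s, (j < i)%N ==> (x j < x i)].

(* For 0 <= theta <= 1/s and m > 0 the range of the maximum is nonempty: in each
   of the s orders fewer than theta * m <= m / s elements (none if theta = 0)
   have their position below theta. All the products are nonnegative, so the
   default value 0 plays no role. *)
Definition fP (s m : nat) (P : 'I_s -> rel 'I_m) (theta : R) : R :=
  \big[Num.max/0]_(k < m | [forall i, theta <= ppoint P k i <= 1])
    \prod_(i < s | ~~ is_imax (ppoint P k) i) ppoint P k i.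

(* There are finitely many, and at least one, (s, m)-preference orders: this
   infimum is a minimum. *)
Definition fm (s : nat) (theta : R) (m : nat) : R :=
  inf [set fP P theta | P in [set P | @preference_order s m P]].

Definition f (s : nat) (theta : R) : R :=
  inf [set fm s theta m | m in [set m | (0 < m)%N]].

End PreferenceOrders.

Section Covers.
Context {R : realType}.

(* V is the vertex set of the hypergraph and Q its set of edges. *)
Definition cover (r : nat) (V : {fset R}) (Q : {fset {fset R}}) : Prop :=
  [/\ {in V, forall y, 0 <= y <= 1},
      {in Q, forall e : {fset R}, #|` e|%fset = r},
      trivIfset Q & fcover Q = V].

(* Products of vertices in [0, 1] are nonnegative. *)
Definition hQ (Q : {fset {fset R}}) : R :=
  \big[Num.max/0]_(e <- Q) \prod_(y <- e) y.

(* The index j ranges over {0, ..., rn - 1}, whence j.+1. *)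
Definition cover_vertices (r : nat) (theta : R) (n : nat) : {fset R} :=
  [fset (theta + (r.+1%:R^-1 - theta) * ((val j).+1%:R / n%:R))%R
     | j : 'I_(r * n)]%fset.

Definition theta_cover (r : nat) (theta : R) (n : nat)
    (Q : {fset {fset R}}) : Prop :=
  cover r (cover_vertices r theta n) Q.

(* There are finitely many covers of a given vertex set, and at least one here
   when 0 <= theta < 1/(r+1) and n > 0: this infimum is a minimum. *)
Definition hn (r : nat) (theta : R) (n : nat) : R :=
  inf [set hQ Q | Q in [set Q | theta_cover r theta n Q]].

Definition hinf (r : nat) (theta : R) : R :=
  inf [set hn r theta n | n in [set n | (0 < n)%N]].

(* h r theta for theta in [0, 1/(r+1)]: at the right endpoint, where the
   vertices of a cover collapse to one point, it is the left limit. *)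
Definition h (r : nat) (theta : R) : R :=
  if theta == r.+1%:R^-1
  then lim (hinf r t @[t --> (r.+1%:R^-1 : R)^'-])
  else hinf r theta.

Definition phi_equation (r : nat) (theta : R) : Prop :=
  theta * (1 - r.+1%:R^-1 - (r.-1)%:R * theta) ^+ r.-1 = h r theta.

Definition is_phi (r : nat) (phi : R) : Prop :=
  [/\ 0 <= phi <= r.+1%:R^-1, phi_equation r phi &
      forall theta : R, 0 <= theta <= r.+1%:R^-1 -> phi_equation r theta ->
        phi <= theta].

End Covers.

(* Main.v *)
Require Import Defs.
From HB Require Import structures.
From mathcomp Require Import all_boot all_order all_algebra finmap.
From mathcomp Require Import all_classical all_reals all_analysis.
From mathcomp Require Import zify lra.

Import Order.TTheory GRing.Theory Num.Theory.
Import numFieldNormedType.Exports.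

Local Open Scope classical_set_scope.
Local Open Scope ring_scope.

(* Write s = r + 1 and g(x) = x (1 - 1/s - (r - 1) x)^(r - 1), and let c = h(0).

   h is nonincreasing: going from theta to theta' > theta, remove every edge
   having a vertex below theta' and push the surviving vertices down onto the
   grid of theta', on which they are at least as sparse. It is also Lipschitz,
   since each vertex depends on theta affinely.

   Conversely a cover for theta extends to one for a smaller parameter by
   joining each new low vertex x to the r - 1 new vertices just below
   1 - 1/s - (r - 1) x; these edges have product about g(x), so
   h(0) <= max(h(theta), sup_[0, theta] g). Hence h = c as long as g < c, and by
   continuity up to the first point phi where g = c. Such a point exists, since
   otherwise h = c up to 1/s, where h equals g.

   For f <= c, a cover for theta = 0 is turned into s orders by placing the s
   cyclic rotations of each edge, completed by a large coordinate. For f >= h,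
   drop the largest coordinate of each point of P lying in [theta, 1]^s; the
   remaining coordinates, pushed down onto a grid, give a cover for b/m, where b
   is the number of positions below theta, and h(b/m) >= h(theta). *)

(** * Covers as arrays of vertex indices *)

Section Packings.
Set Implicit Arguments.
Unset Strict Implicit.

Lemma digits_inj k a a' q q' : (q < k)%N -> (q' < k)%N ->
  (k * a + q = k * a' + q')%N -> a = a' /\ q = q'.
Proof.
move=> qk qk' e; have k0 : (0 < k)%N by apply: leq_ltn_trans qk.
have ea : a = a'.
  have := congr1 (divn^~ k) e.
  by rewrite /= ![(k * _)%N]mulnC !divnMDl // !divn_small // !addn0.
by split=> //; move: e; rewrite ea => /addnI.
Qed.

Context {R : realType} (r : nat).
Implicit Types (theta B : R) (n : nat).

Definition vtx theta n (j : nat) : R :=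
  theta + (r.+1%:R^-1 - theta) * (j.+1%:R / n%:R).

(* Edge [a] of a cover consists of the vertices of index [u a q], and [B] bounds
   the products over the edges. Unlike [theta_cover] this makes sense at
   [theta = 1/(r+1)], where all the vertices coincide. *)
Definition packing n theta B : Prop :=
  exists u : 'I_n -> 'I_r -> nat,
    [/\ injective (fun p : 'I_n * 'I_r => u p.1 p.2),
        forall a q, (u a q < r * n)%N &
        forall a, \prod_q vtx theta n (u a q) <= B].

Lemma vtx_ge_theta theta n j : theta <= r.+1%:R^-1 -> theta <= vtx theta n j.
Proof.
by move=> ht; rewrite lerDl mulr_ge0 ?subr_ge0 ?divr_ge0 ?ler0n.
Qed.

Lemma ratio_le n j : (j < r * n)%N -> j.+1%:R / n%:R <= r%:R :> R.
Proof.
move=> jrn; have n0 : (0 < n)%N by case: n jrn => //; rewrite muln0.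
by rewrite ler_pdivrMr ?ltr0n // -natrM ler_nat.
Qed.

Lemma vtx_le1 theta n j : 0 <= theta <= r.+1%:R^-1 -> (j < r * n)%N ->
  vtx theta n j <= 1.
Proof.
move=> /andP[t0 ts] jrn.
have r1 : 1 <= r%:R :> R by rewrite ler1n; case: r jrn.
apply: (@le_trans _ _ (theta + (r.+1%:R^-1 - theta) * r%:R)).
  by rewrite lerD2l ler_wpM2l ?subr_ge0 // ratio_le.
have rs : r.+1%:R^-1 * (r%:R + 1) = 1 :> R.
  by rewrite natr1 mulVf // pnatr_eq0.
have si : 0 <= r.+1%:R^-1 :> R by rewrite invr_ge0 ler0n.
have : 0 <= theta * (r%:R - 1) by rewrite mulr_ge0 ?subr_ge0.
move: rs si; move: (r.+1%:R^-1) => S; lra.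
Qed.

Lemma vtx_bound theta n j : 0 <= theta <= r.+1%:R^-1 -> (j < r * n)%N ->
  0 <= vtx theta n j <= 1.
Proof.
move=> ht jrn; rewrite vtx_le1 // andbT; case/andP: ht => t0 ts.
by rewrite (le_trans t0) ?vtx_ge_theta.
Qed.

Lemma packing_le n theta B B' : packing n theta B -> B <= B' ->
  packing n theta B'.
Proof.
by move=> [u [ui ul uB]] BB'; exists u; split=> // a; exact: le_trans BB'.
Qed.

Lemma packing_exists n theta : 0 <= theta <= r.+1%:R^-1 -> packing n theta 1.
Proof.
move=> ht; pose u (a : 'I_n) (q : 'I_r) := (r * a + q)%N.
have ul a q : (u a q < r * n)%N.
  by rewrite /u; have := ltn_ord a; have := ltn_ord q; nia.
exists u; split=> //.
  move=> [a q] [a' q'] /=; rewrite /u => e.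
  have [ea eq] := digits_inj (ltn_ord q) (ltn_ord q') e.
  by congr pair; exact: val_inj.
by move=> a; apply: prodr_ile1 => q _; exact: vtx_bound.
Qed.

(** Replacing the factors one at a time costs at most [eps] each, because the other factors lie in
    [0, 1]. *)
Lemma prod_le_perturb (I : Type) (s : seq I) (a b : I -> R) (eps : R) :
    (forall i, 0 <= a i <= 1) -> (forall i, 0 <= b i <= 1) ->
    (forall i, a i <= b i + eps) -> 0 <= eps ->
  \prod_(i <- s) a i <= \prod_(i <- s) b i + (size s)%:R * eps.
Proof.
move=> a01 b01 ab e0; elim: s => [|i s IH].
  by rewrite !big_nil mul0r addr0.
have: 0 <= \prod_(i <- s) b i <= 1.
  by rewrite prodr_ge0 ?prodr_ile1 // => k _; case/andP: (b01 k).
have := ab i; have /andP[ai0 ai1] := a01 i; have /andP[bi0 bi1] := b01 i.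
rewrite !big_cons /= -natr1 mulrDl mul1r; move: IH.
have : 0 <= (size s)%:R * eps by rewrite mulr_ge0 // ler0n.
move: (\prod_(i <- s) a i) (\prod_(i <- s) b i) ((size s)%:R * eps) => A B N.
move=> N0 AB abi /andP[B0 B1].
have : a i * A <= a i * B + a i * N by rewrite -mulrDr ler_wpM2l.
have : a i * N <= N by rewrite ler_piMl.
have : a i * B <= b i * B + eps * B by rewrite -mulrDl ler_wpM2r.
have : eps * B <= eps by rewrite ler_piMr.
lra.
Qed.

(** The array [u] is kept. A vertex is affine in [theta] with slope [1 - (j + 1) / n], of absolute
    value at most [r], and an edge has [r] vertices. *)
Lemma packing_lipschitz n theta theta' B :
    0 <= theta <= r.+1%:R^-1 -> 0 <= theta' <= r.+1%:R^-1 ->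
    packing n theta B ->
  packing n theta' (B + (r * r)%:R * `|theta' - theta|).
Proof.
move=> ht ht' [u [ui ul uB]]; exists u; split=> // a.
apply: (@le_trans _ _ (\prod_q vtx theta n (u a q)
                       + (r * r)%:R * `|theta' - theta|)); last by rewrite lerD2r.
have -> : (r * r)%:R * `|theta' - theta|
  = (size (index_enum 'I_r))%:R * (r%:R * `|theta' - theta|).
  by rewrite /index_enum -enumT size_enum_ord natrM mulrA.
apply: prod_le_perturb => [q|q|q|]; try exact: vtx_bound.
  have r1 : 1 <= r%:R :> R by rewrite ler1n; case: (r) q => // -[].
  rewrite -lerBlDl (le_trans (ler_norm _)) //.
  have -> : vtx theta' n (u a q) - vtx theta n (u a q) =
    (1 - (u a q).+1%:R / n%:R) * (theta' - theta).
    by rewrite /vtx; move: (_ / _) (r.+1%:R^-1) => x S; lra.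
  rewrite normrM ler_wpM2r // ler_norml.
  have := ratio_le (ul a q).
  have : 0 <= (u a q).+1%:R / n%:R :> R by rewrite divr_ge0 ?ler0n.
  by move: (_ / _) => x; lra.
by rewrite mulr_ge0 ?ler0n.
Qed.

(* Sorting the entries by size moves the entry [w x] to a grid point which its
   rank forces to lie below [w x]. *)
Lemma packing_of_entries (E : finType) (w : E * 'I_r -> R) theta B :
    0 <= theta <= r.+1%:R^-1 ->
    (forall x, theta + (r.+1%:R^-1 - theta)
       * (#|[pred y | w y <= w x]|%:R / #|E|%:R) <= w x) ->
    (forall a, \prod_q w (a, q) <= B) ->
  packing #|E| theta B.
Proof.
move=> ht hw hB; pose le := relpre w <=%R.
pose s := sort le (enum {: E * 'I_r}).
have les : sorted le s by apply: sort_sorted => x y; exact: le_total.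
have us : uniq s by rewrite sort_uniq enum_uniq.
have ms x : x \in s by rewrite mem_sort mem_enum.
have ss : size s = (r * #|E|)%N.
  by rewrite size_sort -cardE card_prod card_ord mulnC.
exists (fun a q => index (enum_val a, q) s); split.
- move=> [a q] [a' q'] /= /(congr1 (nth (enum_val a, q) s)).
  by rewrite !nth_index // => -[/enum_val_inj -> ->].
- by move=> a q; rewrite -ss index_mem.
move=> a; apply: le_trans (hB (enum_val a)); apply: ler_prod => q _.
set x := (enum_val a, q); case/andP: (ht) => t0 ts.
rewrite (le_trans t0) ?vtx_ge_theta //=.
apply: le_trans (hw x); rewrite lerD2l ler_wpM2l ?subr_ge0 //.
rewrite ler_wpM2r ?invr_ge0 ?ler0n // ler_nat.
have ix : (index x s < size s)%N by rewrite index_mem.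
(* The first [(index x s).+1] entries of the sorted list are distinct and have value at most [w x],
   so the index of [x] is below its rank. *)
rewrite -[X in (X <= _)%N](size_takel ix).
have := take_uniq (index x s).+1 us => /card_uniqP <-.
apply: subset_leq_card; apply/fintype.subsetP => y /(nthP x) [i].
rewrite size_takel // => ii <-; rewrite nth_take // inE.
rewrite -[X in _ <= w X](nth_index x (ms x)).
have tle : transitive le by move=> ? ? ?; exact: le_trans.
have rle : reflexive le by move=> ?; exact: lexx.
apply: (sorted_leq_nth tle rle x les) => //.
by rewrite inE; apply: leq_ltn_trans ix; rewrite -ltnS.
Qed.

Lemma card_le_of_inj (T : finType) (S : {pred T}) (u : T -> nat) lo hi :
    {in S &, injective u} -> (forall x, x \in S -> lo <= u x < hi)%N ->
  (#|S| <= hi - lo)%N.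
Proof.
move=> ui ub; rewrite -[X in (_ <= X)%N](size_iota lo) cardE.
rewrite -(size_map u); apply: uniq_leq_size.
  rewrite map_inj_in_uniq ?enum_uniq // => x y.
  by rewrite !mem_enum; exact: ui.
move=> y /mapP[x]; rewrite mem_enum => /ub xb ->; rewrite mem_iota.
by case/andP: xb; lia.
Qed.

(** Refines the grid at no cost: vertex [j] is replaced by the [k] finer vertices [k * j + l], none
    of them above it, and every edge splits into [k] edges. *)
Lemma packing_blowup n k theta B : 0 <= theta <= r.+1%:R^-1 -> (0 < k)%N ->
  packing n theta B -> packing (n * k) theta B.
Proof.
move=> ht k0 [u [ui ul uB]]; case/andP: (ht) => t0 ts.
have [-> | n0] := posnP n.
  by exists (fun _ _ => 0%N); split => [[[]]|[]|[]].
have cE : #|{: 'I_n * 'I_k}| = (n * k)%N by rewrite card_prod !card_ord.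
pose U (x : 'I_n * 'I_k * 'I_r) := (k * u x.1.1 x.2 + x.1.2)%N.
have Ui : injective U.
  move=> [[a l] q] [[a' l'] q'] /=; rewrite /U /= => e.
  have [e1 /val_inj ->] := digits_inj (ltn_ord l) (ltn_ord l') e.
  by have [-> ->] := ui (a, q) (a', q') e1.
have nk0 : 0 < (n * k)%:R :> R by rewrite ltr0n muln_gt0 n0.
rewrite -cE; apply: (@packing_of_entries _ (fun x => vtx theta (n * k) (U x))) => //.
  (* At the right endpoint all vertices coincide and comparing them says nothing about indices;
     there the gap factor vanishes. *)
  move=> x; rewrite lerD2l cE; case: (eqVneq theta r.+1%:R^-1) => [->|tn].
    by rewrite subrr !mul0r.
  have g0 : 0 < r.+1%:R^-1 - theta by rewrite subr_gt0 lt_neqAle tn.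
  rewrite ler_pM2l // ler_pM2r ?invr_gt0 // ler_nat.
  rewrite -[X in (_ <= X)%N]subn0; apply: (@card_le_of_inj _ _ U) => [y z _ _|y].
    exact: Ui.
  by rewrite inE lerD2l ler_pM2l // ler_pM2r ?invr_gt0 // ler_nat.
move=> [a l]; apply: le_trans (uB a); apply: ler_prod => q _.
rewrite (le_trans t0) ?vtx_ge_theta //= lerD2l ler_wpM2l ?subr_ge0 //.
rewrite ler_pdivlMr ?ltr0n // mulrAC ler_pdivrMr // -!natrM ler_nat.
by rewrite /U /=; have := ltn_ord l; nia.
Qed.

End Packings.

(** * The function h in terms of packings *)

Section Bridge.
Set Implicit Arguments.
Unset Strict Implicit.
Context {R : realType} (r : nat).
Implicit Types (theta B : R) (n : nat).
Local Notation vtx := (vtx r).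
Local Notation packing := (packing r).

Lemma vtx_inj theta n : theta < r.+1%:R^-1 -> (0 < n)%N ->
  injective (vtx theta n).
Proof.
move=> ts n0 j j' /addrI.
have g0 : r.+1%:R^-1 - theta != 0 by rewrite subr_eq0 gt_eqF.
have nV : n%:R^-1 != 0 :> R by rewrite invr_eq0 pnatr_eq0 -lt0n.
by move=> /(mulfI g0)/(mulIf nV)/eqP; rewrite eqr_nat => /eqP[].
Qed.

Lemma cover_of_packing theta n B : 0 <= theta < r.+1%:R^-1 -> (0 < n)%N ->
    packing n theta B ->
  exists2 Q : {fset {fset R}}, theta_cover r theta n Q & hQ Q <= B.
Proof.
move=> /andP[t0 ts] n0 [u [ui ul uB]].
have tb : 0 <= theta <= r.+1%:R^-1 by rewrite t0 ltW.
have vi := vtx_inj ts n0.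
pose edge (a : 'I_n) : {fset R} := [fset vtx theta n (u a q) | q : 'I_r]%fset.
have ei a : injective (fun q => vtx theta n (u a q)).
  by move=> q q' /vi e; have [] := ui (a, q) (a, q') e.
have ebig a : \prod_(y <- edge a) y = \prod_q vtx theta n (u a q).
  rewrite /edge big_imfset /= => [|q q' _ _]; last exact: ei.
  by rewrite big_enum.
have edge_disj a a' y : y \in edge a -> y \in edge a' -> a = a'.
  move=> /imfsetP[q _ ->] /imfsetP[q' _] /vi e.
  by have [] := ui (a, q) (a', q') e.
exists [fset edge a | a : 'I_n]%fset; last first.
  have B0 : 0 <= B.
    apply: le_trans (uB (Ordinal n0)); apply: prodr_ge0 => q _.
    by rewrite (le_trans t0) // vtx_ge_theta // ltW.
  rewrite /hQ big_seq_cond; apply: bigmax_le => // e /andP[/imfsetP[a _ ->] _].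
  by rewrite ebig.
split.
- by move=> y /imfsetP[j _ ->]; exact: (@vtx_bound R r theta n j tb (ltn_ord j)).
- move=> e /imfsetP[a _ ->]; rewrite card_imfset /=; last exact: ei.
  by rewrite size_enum_ord.
- apply/trivIfsetP => e e' /imfsetP[a _ ->] /imfsetP[a' _ ->] neq.
  apply/fdisjointP => y ya; apply/negP => ya'; move: neq.
  by rewrite (edge_disj _ _ _ ya ya') eqxx.
apply/fsetP => y; apply/bigfcupP/imfsetP => /=.
  move=> [e /andP[/imfsetP[a _ ->] _] /imfsetP[q _ ->]].
  by exists (Ordinal (ul a q)).
move=> [j _ ->].
(* An injection between two sets of size [r * n] is bijective, so every vertex of the grid lies in
   some edge. *)
pose g (p : 'I_n * 'I_r) := Ordinal (ul p.1 p.2).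
have gi : injective g by move=> p p' [] /ui.
have [|g' _ gK] := inj_card_bij gi; first by rewrite card_prod !card_ord mulnC.
exists (edge (g' j).1); first by rewrite andbT; apply/imfsetP; exists (g' j).1.
by apply/imfsetP; exists (g' j).2 => //=; rewrite -[in LHS](gK j).
Qed.

Lemma packing_of_cover theta n (Q : {fset {fset R}}) :
    0 <= theta < r.+1%:R^-1 -> (0 < n)%N -> (0 < r)%N ->
  theta_cover r theta n Q -> packing n theta (hQ Q).
Proof.
move=> /andP[t0 ts] n0 r0 [_ Qr Qtriv QV].
have vi := vtx_inj ts n0.
pose idx y : nat :=
  if [pick j : 'I_(r * n) | vtx theta n j == y] is Some j then j else 0.
have idxP e y : e \in Q -> y \in e ->
    (idx y < r * n)%N /\ vtx theta n (idx y) = y.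
  move=> eQ ye; have /imfsetP[/= j _ yj] : y \in cover_vertices r theta n.
    by rewrite -QV; apply/bigfcupP; exists e; rewrite ?eQ.
  rewrite /idx; case: pickP => [j' /eqP|/(_ j)]; first by split.
  by rewrite yj eqxx.
(* Counting the [r * n] vertices edge by edge leaves exactly [n] edges. *)
have sQ : #|` Q| = n.
  have : (\sum_(e <- Q) #|` e| = r * n)%N.
    rewrite (eqP Qtriv) QV card_imfset /= ?size_enum_ord // => j j'.
    by move=> /vi /val_inj.
  rewrite (eq_big_seq (fun=> r)) => [|e eQ]; last exact: Qr.
  rewrite big_const_seq iter_addn_0 count_predT => /eqP.
  by rewrite eqn_pmul2l // => /eqP.
pose e (a : 'I_n) : {fset R} := nth fset0 Q a.
have eQ a : e a \in Q by apply: mem_nth; rewrite sQ.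
have se a : size (e a) = r by exact: Qr.
have ye a (q : 'I_r) : (e a)`_q \in e a by apply: mem_nth; rewrite se.
exists (fun a q => idx (e a)`_q); split.
- move=> [a q] [a' q'] /= E.
  have [_ Ea] := idxP _ _ (eQ a) (ye a q).
  have [_ Ea'] := idxP _ _ (eQ a') (ye a' q').
  have Y : (e a)`_q = (e a')`_q' by rewrite -Ea -Ea' E.
  have eqe : e a = e a'.
    apply/eqP; apply/negPn/negP => /(elimT (trivIfsetP Q) Qtriv _ _ (eQ a) (eQ a')).
    by move=> /fdisjointP/(_ _ (ye a q)); rewrite Y ye.
  move: Y; rewrite eqe => /eqP; rewrite nth_uniq ?se ?fset_uniq // => /eqP/val_inj ->.
  congr pair; apply: val_inj; apply/eqP.
  have := fset_uniq Q => /(nth_uniq fset0) E'.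
  by rewrite -E' ?sQ ?ltn_ord //; exact/eqP.
- by move=> a q; have [] := idxP _ _ (eQ a) (ye a q).
move=> a.
have -> : \prod_(q < r) vtx theta n (idx (e a)`_q) = \prod_(y <- e a) y.
  rewrite (big_nth 0) big_mkord se; apply: eq_bigr => q _.
  by have [_ ->] := idxP _ _ (eQ a) (ye a q).
exact: (@le_bigmax_seq _ _ _ _ 0 (e a) predT
  (fun e : {fset R} => \prod_(y <- e) y) (eQ a) isT).
Qed.

Lemma hQ_ge0 (Q : {fset {fset R}}) : 0 <= hQ Q.
Proof. exact: bigmax_ge_id. Qed.

Section PositiveUniformity.
Context (r0 : (0 < r)%N).

Lemma covers_nonempty theta n : 0 <= theta < r.+1%:R^-1 -> (0 < n)%N ->
  [set hQ Q | Q in [set Q | theta_cover r theta n Q]] !=set0.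
Proof.
move=> ht n0; have [|Q cQ _] := cover_of_packing ht n0 (packing_exists n _).
  by case/andP: ht => t0 /ltW ts; apply/andP.
by exists (hQ Q), Q.
Qed.

Lemma hn_ge0 theta n : 0 <= theta < r.+1%:R^-1 -> (0 < n)%N ->
  0 <= hn r theta n.
Proof.
move=> ht n0; apply: lb_le_inf; first exact: covers_nonempty.
by move=> _ [Q _ <-]; exact: hQ_ge0.
Qed.

Lemma hinf_le theta n B : 0 <= theta < r.+1%:R^-1 -> (0 < n)%N ->
  packing n theta B -> hinf r theta <= B.
Proof.
move=> ht n0 /(cover_of_packing ht n0)[Q cQ]; apply: le_trans.
apply: (@le_trans _ _ (hn r theta n)).
  apply: ge_inf; last by exists n.
  by exists 0 => _ [k k0 <-]; exact: hn_ge0.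
apply: ge_inf; last by exists Q.
by exists 0 => _ [Q' _ <-]; exact: hQ_ge0.
Qed.

(** Each of the two nested infima is approached to within [eps / 2]. *)
Lemma hinf_packing theta eps : 0 <= theta < r.+1%:R^-1 -> 0 < eps ->
  exists2 n, (0 < n)%N & packing n theta (hinf r theta + eps).
Proof.
move=> ht e0; have e20 : 0 < eps / 2 by rewrite divr_gt0.
have [|_ [n n0 <-] hnlt] := @inf_adherent R
    [set hn r theta k | k in [set k | (0 < k)%N]] _ e20.
  split; first by exists (hn r theta 1), 1%N.
  by exists 0 => _ [k k0 <-]; exact: hn_ge0.
have [|_ [Q cQ <-] hQlt] := @inf_adherent R
    [set hQ Q | Q in [set Q | theta_cover r theta n Q]] _ e20.
  split; first exact: covers_nonempty.
  by exists 0 => _ [Q' _ <-]; exact: hQ_ge0.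
exists n => //; apply: packing_le (packing_of_cover ht n0 r0 cQ) _.
move: hnlt hQlt; rewrite -/(hinf r theta) -/(hn r theta n) => hnlt hQlt.
by rewrite [eps]splitr addrA ltW // (lt_trans hQlt) // ltrD2r.
Qed.

Lemma vtx_end n j : vtx r.+1%:R^-1 n j = r.+1%:R^-1 :> R.
Proof. by rewrite /vtx subrr mul0r addr0. Qed.

Lemma packing_end_ge n B : (0 < n)%N ->
  packing n r.+1%:R^-1 B -> r.+1%:R^-1 ^+ r <= B.
Proof.
move=> n0 [u [_ _ /(_ (Ordinal n0))]]; apply: le_trans.
by under eq_bigr do rewrite vtx_end; rewrite prodr_const card_ord.
Qed.

Lemma end_bound : (0 : R) <= r.+1%:R^-1 <= (r.+1%:R^-1 : R).
Proof. by rewrite lexx invr_ge0 ler0n. Qed.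

Lemma packing_end n : packing n (r.+1%:R^-1 : R) (r.+1%:R^-1 ^+ r).
Proof.
have [u [ui ul _]] := packing_exists n end_bound; exists u; split=> // a.
by under eq_bigr do rewrite vtx_end; rewrite prodr_const card_ord.
Qed.

(** [packing_lipschitz] is applied in both directions between [theta] and the endpoint, where every
    edge has the same product. This gives the left limit that defines [h] there. *)
Lemma hinf_near_end theta : 0 <= theta < r.+1%:R^-1 ->
  `|r.+1%:R^-1 ^+ r - hinf r theta| <= (r * r)%:R * (r.+1%:R^-1 - theta).
Proof.
move=> ht; case/andP: (ht) => t0 ts.
have tb : 0 <= theta <= r.+1%:R^-1 by rewrite t0 ltW.
have d1 : `|theta - r.+1%:R^-1| = r.+1%:R^-1 - theta.
  by rewrite distrC gtr0_norm // subr_gt0.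
have d2 : `|r.+1%:R^-1 - theta| = r.+1%:R^-1 - theta by rewrite distrC.
have hi : hinf r theta <= r.+1%:R^-1 ^+ r + (r * r)%:R * (r.+1%:R^-1 - theta).
  rewrite -d1; apply: (@hinf_le _ 1%N) => //.
  exact: packing_lipschitz end_bound tb (packing_end 1).
have lo : r.+1%:R^-1 ^+ r <= hinf r theta + (r * r)%:R * (r.+1%:R^-1 - theta).
  apply/ler_addgt0Pr => eps e0; have [n n0 pk] := hinf_packing ht e0.
  have := packing_lipschitz tb end_bound pk; rewrite d2 => /(packing_end_ge n0).
  by rewrite addrAC.
rewrite ler_norml; move: hi lo; move: (_ ^+ r) (_ * _) (hinf _ _) => a b c; lra.
Qed.

Lemma h_end : h r r.+1%:R^-1 = r.+1%:R^-1 ^+ r :> R.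
Proof.
rewrite /h eqxx; apply: cvg_lim => //; apply/cvgrPdist_le => eps e0.
have C0 : 0 < (r * r)%:R :> R by rewrite ltr0n muln_gt0 r0.
near=> t.
have ht : 0 <= t < r.+1%:R^-1.
  apply/andP; split; last by near: t; exact: nbhs_left_lt.
  by near: t; apply: nbhs_left_ge; rewrite invr_gt0 ltr0n.
apply: le_trans (hinf_near_end ht) _.
rewrite -ler_pdivlMl // lerBlDl -lerBlDr.
near: t; apply: nbhs_left_ge; rewrite ltrBlDr ltrDl.
by rewrite mulr_gt0 // invr_gt0.
Unshelve. all: by end_near. Qed.

(** Together with [h_packing], this describes [h] by packings on the whole closed interval, so that
    later arguments need not unfold the limit at the endpoint. *)
Lemma h_le_packing theta n B : 0 <= theta <= r.+1%:R^-1 -> (0 < n)%N ->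
  packing n theta B -> h r theta <= B.
Proof.
move=> /andP[t0]; rewrite le_eqVlt => /predU1P[-> n0|ts n0].
  by rewrite h_end; exact: packing_end_ge.
by rewrite /h lt_eqF //; apply: hinf_le; rewrite // t0.
Qed.

Lemma h_packing theta eps : 0 <= theta <= r.+1%:R^-1 -> 0 < eps ->
  exists2 n, (0 < n)%N & packing n theta (h r theta + eps).
Proof.
move=> /andP[t0]; rewrite le_eqVlt => /predU1P[->|ts] e0.
  exists 1%N => //; rewrite h_end; apply: packing_le (packing_end 1) _.
  by rewrite lerDl ltW.
by rewrite /h lt_eqF //; apply: hinf_packing; rewrite // t0.
Qed.

Lemma h_lipschitz theta theta' :
    0 <= theta <= r.+1%:R^-1 -> 0 <= theta' <= r.+1%:R^-1 ->
  h r theta' <= h r theta + (r * r)%:R * `|theta' - theta|.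
Proof.
move=> ht ht'; apply/ler_addgt0Pr => eps e0.
have [n n0 pk] := h_packing ht e0.
by rewrite addrAC; apply: (h_le_packing ht' n0); exact: packing_lipschitz pk.
Qed.

End PositiveUniformity.
End Bridge.

(** * Shrinking and extending packings *)

Section Mono.
Set Implicit Arguments.
Unset Strict Implicit.
Context {R : realType} (r : nat).
Implicit Types (theta B : R) (n : nat).
Local Notation vtx := (vtx r).
Local Notation packing := (packing r).

Lemma vtx_le_mono theta n j j' : theta < r.+1%:R^-1 -> (0 < n)%N ->
  (vtx theta n j <= vtx theta n j') = (j <= j')%N.
Proof.
move=> ts n0; rewrite lerD2l ler_pM2l ?subr_gt0 //.
by rewrite ler_pM2r ?invr_gt0 ?ltr0n // ler_nat.
Qed.

(** Serves to check the sparsity hypothesis of [packing_of_entries]: a gap [delta * N] shared among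
    [G >= N] edges has step at most [delta]. *)
Lemma step_mul_le (delta : R) (N G cnt c : nat) : 0 <= delta ->
  (N <= G)%N -> (cnt <= c)%N ->
  delta * N%:R * (cnt%:R / G%:R) <= delta * c%:R.
Proof.
move=> d0 NG cc; rewrite -mulrA ler_wpM2l //.
case: G NG => [|G] NG; first by rewrite invr0 !mulr0 ler0n.
rewrite mulrCA -[leRHS]mulr1 ler_pM ?ler0n ?ler_nat ?divr_ge0 ?ler0n //.
by rewrite ler_pdivrMr ?ltr0n // mul1r ler_nat.
Qed.

Lemma step_le_inv n k theta : 0 <= theta -> (0 < n)%N ->
  (r.+1%:R^-1 - theta) / (n * k)%:R <= k%:R^-1.
Proof.
move=> t0 n0; rewrite natrM invfM mulrA ler_piMl ?invr_ge0 ?ler0n //.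
rewrite ler_pdivrMr ?ltr0n // mul1r (@le_trans _ _ 1) ?ler1n //.
by rewrite (@le_trans _ _ r.+1%:R^-1) ?gerBl // invf_le1 ?ler1n ?ltr0n.
Qed.

Lemma exists_step (C eps : R) : 0 < eps -> exists2 k, (0 < k)%N & C / k%:R <= eps.
Proof.
move=> e0; exists (Num.bound (`|C| / eps)).+1 => //.
rewrite ler_pdivrMr ?ltr0n // -ler_pdivrMl // mulrC.
apply: (@le_trans _ _ (`|C| / eps)); first by rewrite ler_pM2r ?invr_gt0 ?ler_norm.
apply: ltW; apply: lt_trans (archi_boundP _) _; last by rewrite ltr_nat.
by rewrite divr_ge0 // ltW.
Qed.

(** The upper bound is weak so that [x = N] is allowed with [b = N - 1]: [packing_drop_low] asks for
    [b < n] even when the target parameter is the right endpoint. *)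
Lemma exists_floor_lt (x : R) N : (0 < N)%N -> 0 <= x <= N%:R ->
  exists2 b, (b < N)%N & b%:R <= x <= b.+1%:R.
Proof.
case: N => // N _; elim: N => [|N IH] /andP[x0 xN].
  by exists 0%N => //; rewrite x0.
have [xle|/ltW xge] := leP x N.+1%:R; last by exists N.+1 => //; rewrite xge.
by have [|b bN bx] := IH; [rewrite x0|exists b => //; exact: ltnW].
Qed.

(** The vertices of index below [b] meet at most [b] edges. On the other edges at most [j + 1 - b]
    vertices have index at most [j], which is the sparsity that [packing_of_entries] requires for
    the raised parameter. *)
Lemma packing_drop_low n b theta B : 0 <= theta < r.+1%:R^-1 -> (b < n)%N ->
    packing n theta B ->
  exists2 G, (0 < G)%N
    & packing G (theta + (r.+1%:R^-1 - theta) / n%:R * b%:R) B.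
Proof.
move=> /andP[t0 ts] bn [u [ui ul uB]].
have n0 : (0 < n)%N by apply: leq_ltn_trans bn.
set delta := _ / n%:R.
have d0 : 0 <= delta by rewrite divr_ge0 ?ler0n // subr_ge0 ltW.
have gapE : r.+1%:R^-1 - theta = delta * n%:R.
  by rewrite /delta divfK // pnatr_eq0 -lt0n.
have vtxE j : vtx theta n j = theta + delta * j.+1%:R.
  by rewrite /vtx /delta; congr (_ + _); rewrite mulrCA mulrC.
clearbody delta.
pose good := [pred a : 'I_n | [forall q, (b <= u a q)%N]].
have Gn : (n - b <= #|{: {a | good a}}|)%N.
  rewrite card_sig leq_subCl.
  have -> : (n - #|[pred a | good a]| = #|[predC good]|)%N.
    by rewrite -[X in (X - _)%N](card_ord n) -(cardC good) addKn.
  (* Edges being disjoint, choosing a vertex of index below [b] in each discarded edge is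
     injective. *)
  pose low a := if [pick q | (u a q < b)%N] is Some q then u a q else b.
  have lowP a : ~~ good a -> exists2 q, low a = u a q & (u a q < b)%N.
    rewrite /low negb_forall => /existsP[q]; rewrite -ltnNge => uq.
    by case: pickP => [q' ?|/(_ q)]; [exists q'|rewrite uq].
  rewrite -[X in (_ <= X)%N]subn0; apply: (@card_le_of_inj _ _ low).
    move=> a a'; rewrite !inE => /lowP[q -> _] /lowP[q' -> _] e.
    by have [] := ui (a, q) (a', q') e.
  by move=> a; rewrite inE => /lowP[q ->].
have G0 : (0 < #|{: {a | good a}}|)%N by apply: leq_trans Gn; rewrite subn_gt0.
exists #|{: {a | good a}}| => //.
have gap' : r.+1%:R^-1 - (theta + delta * b%:R) = delta * (n - b)%:R.
  by rewrite opprD addrA gapE natrB ?mulrBr // ltnW.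
apply: (@packing_of_entries _ _ _
  (fun x : {a | good a} * 'I_r => vtx theta n (u (val x.1) x.2))).
- apply/andP; split; first by rewrite addr_ge0 ?mulr_ge0 ?ler0n.
  by rewrite -subr_ge0 gap' mulr_ge0 ?ler0n.
- move=> [[a ga] q] /=; rewrite gap' [leRHS]vtxE.
  have bu : (b <= u a q)%N by apply: (forallP ga).
  have -> : (u a q).+1 = (b + ((u a q).+1 - b))%N by rewrite subnKC // ltnW.
  rewrite natrD mulrDr addrA lerD2l; apply: step_mul_le => //.
  apply: (@card_le_of_inj _ _ (fun x : {a | good a} * 'I_r => u (val x.1) x.2)).
    move=> [a1 q1] [a2 q2] _ _ /= e.
    by have [/val_inj -> ->] := ui (val a1, q1) (val a2, q2) e.
  move=> [[a1 ga1] q1]; rewrite inE vtx_le_mono //= ltnS => ->; rewrite andbT.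
  exact: (forallP ga1).
- by move=> [a ga] /=.
Qed.

Section PositiveUniformity.
Context (r0 : (0 < r)%N).

(** Dropping edges reaches only the parameters [theta + delta * b]. A refined grid has one of them
    within [delta] of [theta'], and the Lipschitz bound covers the rest. *)
Lemma h_nonincreasing theta theta' :
  0 <= theta -> theta <= theta' -> theta' <= r.+1%:R^-1 ->
  h r theta' <= h r theta.
Proof.
move=> t0 tt' ts'; have [->//|ne] := eqVneq theta' theta.
have ts : theta < r.+1%:R^-1 by apply: lt_le_trans ts'; rewrite lt_neqAle eq_sym ne.
have tb : 0 <= theta <= r.+1%:R^-1 by rewrite t0 ltW.
have tb' : 0 <= theta' <= r.+1%:R^-1 by rewrite ts' (le_trans t0).
apply/ler_addgt0Pr => eps e0; have e20 : 0 < eps / 2 by rewrite divr_gt0.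
have [n n0 pk] := h_packing r0 tb e20.
have [k k0 ke] := exists_step (r * r)%:R e20.
have nk0 : (0 < n * k)%N by rewrite muln_gt0 n0.
have := packing_blowup tb k0 pk.
set delta := (r.+1%:R^-1 - theta) / (n * k)%:R => pk'.
have d0 : 0 < delta by rewrite divr_gt0 ?subr_gt0 ?ltr0n.
have dk : delta <= k%:R^-1 by exact: step_le_inv.
have [|b bnk /andP[b1 b2]] := @exists_floor_lt ((theta' - theta) / delta) _ nk0.
  rewrite divr_ge0 ?subr_ge0 // ?(ltW d0) //= ler_pdivrMr // /delta.
  by rewrite mulrC divfK ?pnatr_eq0 -?lt0n // lerD2r.
have [|G G0] := packing_drop_low _ bnk pk'; first by rewrite t0.
rewrite -/delta => pkG; clearbody delta.
move: b1 b2; rewrite ler_pdivlMr // ler_pdivrMr // -natr1 => b1 b2.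
have tb2 : 0 <= theta + delta * b%:R <= r.+1%:R^-1.
  rewrite addr_ge0 ?mulr_ge0 ?ler0n ?(ltW d0) //= (le_trans _ ts') //.
  by rewrite mulrC -lerBrDl.
apply: le_trans (h_le_packing r0 tb' G0 (packing_lipschitz tb2 tb' pkG)) _.
rewrite [eps in leRHS]splitr addrA lerD2l (le_trans _ ke) // ler_wpM2l ?ler0n //.
apply: le_trans dk; rewrite ger0_norm; move: b1 b2; move: (b%:R) => x; nra.
Qed.

(** Lowering [theta] by [b] steps while adding [b] edges preserves the step [delta]; old vertex [j]
    becomes new vertex [b + j]. *)
Lemma vtx_extend theta n b (delta := (r.+1%:R^-1 - theta) / n%:R) j :
  (0 < n)%N ->
  vtx (theta - delta * b%:R) (n + b) j = theta - delta * b%:R + delta * j.+1%:R.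
Proof.
move=> n0; rewrite /vtx; congr (_ + _).
have -> : r.+1%:R^-1 - (theta - delta * b%:R) = delta * (n + b)%:R.
  rewrite natrD mulrDr /delta divfK ?pnatr_eq0 -?lt0n //.
  by rewrite opprB addrA addrAC.
rewrite -mulrA; congr (_ * _); rewrite mulrCA divff ?mulr1 //.
by rewrite pnatr_eq0 addn_eq0 negb_and -lt0n n0.
Qed.

(* Each new low vertex forms an edge with [r - 1] of the new vertices at the
   top of the range, the lowest vertices being joined to the highest ones. *)
Lemma packing_extend n b theta B K (delta := (r.+1%:R^-1 - theta) / n%:R) :
    0 <= theta <= r.+1%:R^-1 -> (0 < n)%N -> delta * b%:R <= theta ->
    (forall x, 0 <= x <= theta ->
      x * (1 - r.+1%:R^-1 - r.-1%:R * x) ^+ r.-1 <= K) ->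
    K + delta <= B -> packing n theta B ->
  packing (n + b) (theta - delta * b%:R) B.
Proof.
move=> /andP[t0 ts] n0 bt gK KB [u [ui ul uB]].
have d0 : 0 <= delta by rewrite divr_ge0 ?ler0n // subr_ge0.
have sE : r.+1%:R^-1 = theta + delta * n%:R.
  by rewrite /delta divfK ?pnatr_eq0 -?lt0n // subrKC.
have vtxE j : vtx theta n j = theta + delta * j.+1%:R.
  by rewrite /vtx /delta mulrAC mulrA.
have vtxE' j : vtx (theta - delta * b%:R) (n + b) j
    = theta - delta * b%:R + delta * j.+1%:R by exact: vtx_extend.
(* Indices below [b] are the new low vertices, the next [r * n] the old ones, and the last
   [r.-1 * b] the new top ones, cut into [b] blocks of size [r.-1]. Low vertex [t] takes block
   [b - t - 1]. *)
clearbody delta; pose U (x : 'I_n + 'I_b) (q : 'I_r) : nat :=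
  match x with
  | inl a => b + u a q
  | inr t => if val q == 0%N then val t
             else (b + r * n + (r.-1 * (b - t.+1) + q.-1))%N
  end.
have Ui a q a' q' : U a q = U a' q' -> a = a' /\ q = q'.
  case: a a' => [a|t] [a'|t'] /=.
  - by move=> /addnI e; have [-> ->] := ui (a, q) (a', q') e.
  - have := ul a q; have := ltn_ord t'; case: ifP => _; lia.
  - have := ul a' q'; have := ltn_ord t; case: ifP => _; lia.
  have := ltn_ord t; have := ltn_ord t'.
  have := ltn_ord q; have := ltn_ord q'.
  case: ifP => [/eqP q0|q0]; case: ifP => [/eqP q0'|q0'] ? ? ? ? e.
  - by split; [congr inr; exact: val_inj|apply: val_inj; rewrite /= q0 q0'].
  - by lia.
  - by lia.
  move/addnI: e => /digits_inj [] ; [lia|lia|] => e1 e2.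
  by split; [congr inr; apply: val_inj => /=; lia|apply: val_inj => /=; lia].
exists (fun a => U (fintype.split a)); split.
- by move=> [a q] [a' q'] /= /Ui [/(can_inj fintype.splitK) -> ->].
- move=> a q; case: (fintype.split a) => [a'|t] /=; first by have := ul a' q; nia.
  have := ltn_ord t; have := ltn_ord q; case: ifP => [_|]; first by nia.
  move: (val t) (val q) => x y; move: r0; case: (r) => // p _ /= y0 yp xb.
  have : (p * (b - x.+1).+1 <= p * b)%N by rewrite leq_mul2l; lia.
  by rewrite mulnS !mulSn mulnDr; lia.
move=> a; case: (fintype.split a) => [a'|t] /=.
  apply: le_trans (uB a'); rewrite le_eqVlt; apply/orP; left; apply/eqP.
  apply: eq_bigr => q _; rewrite vtxE vtxE'.
  by rewrite -addnS natrD mulrDr addrA subrK.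
(* The low vertex of the edge is [x + delta], and the vertices joined to it are at most [T]. Since
   [T <= 1], the product exceeds [x * T ^+ r.-1] by at most [delta]. *)
pose q0 := Ordinal r0; pose x := theta - delta * b%:R + delta * (val t)%:R.
pose T := 1 - r.+1%:R^-1 - r.-1%:R * x.
have rs : r.+1%:R^-1 * (r.-1%:R + 2) = 1 :> R.
  by rewrite -natrD addn2 prednK // mulVf // pnatr_eq0.
have x0 : 0 <= x by rewrite addr_ge0 ?subr_ge0 // mulr_ge0 ?ler0n.
have xt : x <= theta.
  rewrite /x -addrA gerDl addrC subr_le0 ler_wpM2l // ler_nat.
  exact: ltnW (ltn_ord t).
have p0 : 0 <= r.-1%:R :> R by [].
have T0 : 0 <= T.
  rewrite /T; have : r.-1%:R * x <= r.-1%:R * r.+1%:R^-1.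
    by rewrite ler_wpM2l // (le_trans xt).
  have : 0 <= r.+1%:R^-1 :> R by rewrite invr_ge0 ler0n.
  by move: rs; move: (r.+1%:R^-1) (r.-1%:R) => S p; lra.
have T1 : T <= 1.
  rewrite /T; have : 0 <= r.-1%:R * x by rewrite mulr_ge0.
  have : 0 <= r.+1%:R^-1 :> R by rewrite invr_ge0 ler0n.
  by move: (r.+1%:R^-1) (r.-1%:R * x) => S p; lra.
rewrite (bigD1 q0) //= vtxE'.
apply: (@le_trans _ _ ((x + delta) * T ^+ r.-1)); last first.
  rewrite mulrDl; apply: le_trans KB; rewrite lerD ?gK ?x0 //.
  by rewrite ler_piMr // exprn_ile1.
have -> : theta - delta * b%:R + delta * (val t).+1%:R = x + delta.
  by rewrite -natr1 mulrDr mulr1 addrA.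
have xd0 : 0 <= x + delta by exact: (addr_ge0 x0 d0).
rewrite ler_wpM2l //.
have -> : T ^+ r.-1 = \prod_(q < r | q != q0) T.
  by rewrite prodr_const cardC1 card_ord.
apply: ler_prod => q qq0; have qn0 : (val q == 0%N) = false by apply/negbTE.
rewrite qn0 vtxE' addr_ge0 ?subr_ge0 ?mulr_ge0 ?ler0n //=.
apply: (@le_trans _ _ (theta - delta * b%:R
    + delta * (b + r * n + r.-1 * (b - t))%:R)).
  rewrite lerD2l ler_wpM2l // ler_nat.
  have := ltn_ord t; have := ltn_ord q; move: qn0 => /negbT /=.
  clear -r0; move: (nat_of_ord t) (nat_of_ord q) => y z; move: r0; case: (r) => // p _ /= z0 zp yb.
  have -> : (b - y = (b - y.+1).+1)%N by lia.
  by rewrite mulnS; lia.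
have tb : (t <= b)%N by exact: ltnW.
rewrite !natrD !natrM natrB // -[X in X%:R * n%:R](prednK r0) -natr1 /T /x.
move: rs sE.
move: (r.+1%:R^-1) (r.-1%:R) (b%:R) ((val t)%:R) (n%:R) => S p y z m.
nra.
Qed.

End PositiveUniformity.
End Mono.

(** * The interval on which h is constant *)

Section Const.
Set Implicit Arguments.
Unset Strict Implicit.
Context {R : realType} (r : nat).
Implicit Types (theta B : R) (n : nat).
Local Notation vtx := (vtx r).
Local Notation packing := (packing r).
Context (r0 : (0 < r)%N).

Definition phi_lhs (x : R) : R := x * (1 - r.+1%:R^-1 - r.-1%:R * x) ^+ r.-1.

Lemma phi_lhs_continuous : continuous phi_lhs.
Proof.
move=> x; apply: cvgM; first exact: cvg_id.
apply: (@continuous_comp _ _ _ (fun x : R => 1 - r.+1%:R^-1 - r.-1%:R * x)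
  (fun y => y ^+ r.-1)); last exact: exprn_continuous.
by apply: cvgB; [exact: cvg_cst|apply: cvgM; [exact: cvg_cst|exact: cvg_id]].
Qed.

(** By [h_end] this is also the value of [h] at the endpoint, so [phi_lhs] cannot stay below [h r 0]
    on the whole interval. *)
Lemma phi_lhs_end : phi_lhs r.+1%:R^-1 = r.+1%:R^-1 ^+ r.
Proof.
rewrite /phi_lhs.
have -> : 1 - r.+1%:R^-1 - r.-1%:R * r.+1%:R^-1 = r.+1%:R^-1 :> R.
  have : r.+1%:R^-1 * (r.-1%:R + 2) = 1 :> R.
    by rewrite -natrD addn2 prednK // mulVf // pnatr_eq0.
  by move: (r.+1%:R^-1) (r.-1%:R) => S p; lra.
by rewrite -exprS prednK.
Qed.

(** A refined packing for [theta] is extended downwards by as many whole steps as fit in [theta];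
    this ends within one step of 0, and the Lipschitz bound does the rest. *)
Lemma h0_le theta K : 0 <= theta < r.+1%:R^-1 ->
    (forall x, 0 <= x <= theta -> phi_lhs x <= K) ->
  h r 0 <= Num.max (h r theta) K.
Proof.
move=> /andP[t0 ts] gK; set B := Num.max _ _.
have hB : h r theta <= B by rewrite le_max lexx.
have KB : K <= B by rewrite le_max lexx orbT.
clearbody B; apply/ler_addgt0Pr => eps e0.
have e20 : 0 < eps / 2 by rewrite divr_gt0.
have tb : 0 <= theta <= r.+1%:R^-1 by rewrite t0 ltW.
have [n n0 pk] := h_packing r0 tb e20.
(* One [delta] pays for the new edges and [r * r] times [delta] for the final move to 0. *)
have [k k0 ke] := exists_step (1 + (r * r)%:R) e20.
have nk0 : (0 < n * k)%N by rewrite muln_gt0 n0.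
have pk' := packing_blowup tb k0 pk.
have := @packing_extend _ _ r0 _ (Num.truncn (theta / ((r.+1%:R^-1 - theta) / (n * k)%:R)))
  _ (B + eps / 2 + (r.+1%:R^-1 - theta) / (n * k)%:R) K tb nk0.
set delta := (r.+1%:R^-1 - theta) / (n * k)%:R.
have d0 : 0 < delta by rewrite divr_gt0 ?subr_gt0 ?ltr0n.
have dk : delta <= k%:R^-1 by exact: step_le_inv.
clearbody delta; set b := Num.truncn _ => pkE.
have /andP[b1 b2] : b%:R <= theta / delta < b.+1%:R.
  by apply: truncn_itv; rewrite divr_ge0 // ltW.
move: b1 b2; rewrite ler_pdivlMr // ltr_pdivrMr // -natr1 => b1 b2.
have bt : delta * b%:R <= theta by rewrite mulrC.
have {}pkE := pkE bt gK.
have {}pkE : packing (n * k + b) (theta - delta * b%:R) (B + eps / 2 + delta).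
  apply: pkE; first by rewrite lerD2r (le_trans KB) // lerDl ltW.
  apply: packing_le pk' _; rewrite -[leLHS]addr0 lerD ?(ltW d0) //.
  by rewrite lerD2r.
have z : 0 <= (0 : R) <= r.+1%:R^-1 by rewrite lexx invr_ge0 ler0n.
have tb' : 0 <= theta - delta * b%:R <= r.+1%:R^-1.
  rewrite subr_ge0 bt /= (le_trans _ (ltW ts)) // gerBl mulr_ge0 ?ler0n //.
  exact: ltW.
have nkb0 : (0 < n * k + b)%N by rewrite addn_gt0 nk0.
apply: le_trans (h_le_packing r0 z nkb0 (packing_lipschitz tb' z pkE)) _.
rewrite [eps in leRHS]splitr !addrA -[leLHS]addrA lerD2l (le_trans _ ke) //.
have dd : `|0 - (theta - delta * b%:R)| <= delta.
  rewrite sub0r normrN ger0_norm ?subr_ge0 //.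
  by move: b2; move: (b%:R) => x; nra.
rewrite mulrDl mul1r lerD // ler_wpM2l ?ler0n //.
exact: le_trans dk.
Qed.

(** For [theta < phi] the maximum of [phi_lhs] on [0, theta] is attained, hence still below [h r 0],
    and [h0_le] leaves only [h r theta]. The Lipschitz bound then lets [theta] tend to [phi]. *)
Lemma h0_le_of_phi_lhs_lt phi : 0 <= phi <= r.+1%:R^-1 ->
    (forall x, 0 <= x < phi -> phi_lhs x < h r 0) ->
  h r 0 <= h r phi.
Proof.
move=> /andP[p0 ps] gc; move: p0; rewrite le_eqVlt => /predU1P[<-//|p0].
have lt theta : 0 <= theta < phi -> h r 0 <= h r theta.
  move=> /andP[t0 tp].
  have gcont : {within `[0, theta], continuous phi_lhs}.
    exact: continuous_subspaceT phi_lhs_continuous.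
  have [x] := EVT_max t0 gcont; rewrite in_itv /= => /andP[x0 xt] xmax.
  have gx : phi_lhs x < h r 0 by rewrite gc // x0 (le_lt_trans xt).
  have tS : 0 <= theta < r.+1%:R^-1 by rewrite t0 (lt_le_trans tp).
  have xm y : 0 <= y <= theta -> phi_lhs y <= phi_lhs x.
    by move=> yt; apply: xmax; rewrite in_itv.
  by have := h0_le tS xm; rewrite le_max [_ <= phi_lhs x]leNgt gx orbF.
apply/ler_addgt0Pr => eps e0.
have C0 : 0 < (r * r)%:R :> R by rewrite ltr0n muln_gt0 r0.
pose theta := Num.max 0 (phi - eps / (r * r)%:R).
have t0 : 0 <= theta by rewrite le_max lexx.
have tp : theta < phi by rewrite gt_max p0 ltrBlDr ltrDl divr_gt0.
have te : phi - theta <= eps / (r * r)%:R.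
  by rewrite lerBlDr addrC -lerBlDr le_max lexx orbT.
clearbody theta; apply: le_trans (lt theta _) _; first by rewrite t0.
have pb : 0 <= phi <= r.+1%:R^-1 by rewrite ps ltW.
have tb : 0 <= theta <= r.+1%:R^-1 by rewrite t0 (le_trans (ltW tp)).
apply: le_trans (h_lipschitz r0 pb tb) _; rewrite lerD2l distrC.
by rewrite gtr0_norm ?subr_gt0 // -ler_pdivlMl // mulrC.
Qed.

Lemma h_constant :
  exists phi, is_phi r phi /\ forall theta, 0 <= theta <= phi -> h r theta = h r 0.
Proof.
set c := h r 0.
have S0 : 0 < r.+1%:R^-1 :> R by rewrite invr_gt0 ltr0n.
have hle theta : 0 <= theta <= r.+1%:R^-1 -> h r theta <= c.
  by move=> /andP[t0 ts]; exact: h_nonincreasing.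
have c0 : 0 < c.
  apply: lt_le_trans (hle r.+1%:R^-1 _); last by rewrite lexx ltW.
  by rewrite h_end // exprn_gt0.
pose A := [set x : R | 0 <= x <= r.+1%:R^-1 /\ c <= phi_lhs x].
have A0 : A !=set0.
  apply/set0P/negP => /eqP A0.
  have gc x : 0 <= x <= r.+1%:R^-1 -> phi_lhs x < c.
    by move=> xb; rewrite ltNge; apply/negP => cx; have : A x by []; rewrite A0.
  have Sb := @end_bound R r.
  have := gc _ Sb; rewrite phi_lhs_end -h_end // ltNge => /negP; apply.
  apply: h0_le_of_phi_lhs_lt => // x /andP[x0 /ltW xs].
  by apply: gc; rewrite x0.
have Alb : has_lbound A by exists 0 => x [/andP[]].
pose phi := inf A.
have phi_ge0 : 0 <= phi by apply: lb_le_inf => // x [/andP[]].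
have phi_leA x : A x -> phi <= x by exact: ge_inf.
have phi_leS : phi <= r.+1%:R^-1.
  by have [x Ax] := A0; apply: le_trans (phi_leA _ Ax) _; case: Ax => /andP[].
have phi_lt x : 0 <= x < phi -> phi_lhs x < c.
  move=> /andP[x0 xp]; rewrite ltNge; apply/negP => cx.
  have : A x by split=> //; rewrite x0 (le_trans (ltW xp)).
  by move/phi_leA; rewrite leNgt xp.
have phi_b : 0 <= phi <= r.+1%:R^-1 by rewrite phi_ge0.
have hconst theta : 0 <= theta <= phi -> h r theta = c.
  move=> /andP[t0 tp]; have tb : 0 <= theta <= r.+1%:R^-1 by rewrite t0 (le_trans tp).
  apply/eqP; rewrite eq_le hle //=; apply: h0_le_of_phi_lhs_lt => // x /andP[x0 xt].
  by apply: phi_lt; rewrite x0 (lt_le_trans xt).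
(* Otherwise [phi_lhs] would be below [c] near [phi], although [A] has points arbitrarily close to
   its infimum. *)
have g_ge : c <= phi_lhs phi.
  rewrite leNgt; apply/negP => glt.
  have [e /= e0 be] := (nbhs_ballP phi _).1 (cvgr_lt _ (@phi_lhs_continuous phi) _ glt).
  have [x Ax xlt] := inf_adherent e0 (conj A0 Alb).
  have /be : ball phi e x.
    rewrite /ball /= distrC ger0_norm ?subr_ge0 ?phi_leA //.
    by rewrite ltrBlDl.
  by case: Ax => _ cx; rewrite ltNge cx.
(* Positivity provides points to the left of [phi], where [phi_lt] applies. *)
have phi_gt0 : 0 < phi.
  rewrite lt_neqAle phi_ge0 andbT; apply/eqP => p0.
  by move: g_ge; rewrite -p0 /phi_lhs mul0r leNgt c0.
have g_le : phi_lhs phi <= c.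
  rewrite leNgt; apply/negP => ggt.
  have [e /= e0 be] := (nbhs_ballP phi _).1 (cvgr_gt _ (@phi_lhs_continuous phi) _ ggt).
  pose x := Num.max 0 (phi - e / 2).
  have x0 : 0 <= x by rewrite le_max lexx.
  have xp : x < phi by rewrite gt_max phi_gt0 ltrBlDr ltrDl divr_gt0.
  have /be : ball phi e x.
    rewrite /ball /= gtr0_norm ?subr_gt0 //.
    rewrite ltrBlDr addrC -ltrBlDr lt_max; apply/orP; right.
    by rewrite ltrD2l ltrN2 ltr_pdivrMr // mulr_natr mulr2n ltrDl.
  by rewrite ltNge ltW // phi_lt // x0.
have gE : phi_lhs phi = c by apply/eqP; rewrite eq_le g_le.
exists phi; split=> //; split=> //.
  by rewrite /phi_equation -/(phi_lhs phi) gE hconst // phi_ge0 lexx.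
(* A smaller solution would give [phi_lhs theta = h r theta = c], whereas [phi_lhs] is below [c]
   before [phi]. *)
move=> theta /andP[t0 ts] eqt; rewrite leNgt; apply/negP => tp.
have := phi_lt theta; rewrite t0 tp => /(_ isT).
by rewrite /phi_lhs eqt hconst ?ltxx // t0 ltW.
Qed.

End Const.

(** * Preference orders *)

Section Orders.
Set Implicit Arguments.
Unset Strict Implicit.
Context {R : realType} (r : nat).
Implicit Types (theta B : R) (n : nat).
Local Notation vtx := (vtx r).
Local Notation packing := (packing r).

(** Turns [is_imax] into a test against one index, the least maximizer, so that products over the
    other coordinates can be reindexed. *)
Lemma is_imaxP (x : 'I_r.+1 -> R) :
  exists2 i0, forall i, is_imax x i = (i == i0) & forall i, x i <= x i0.
Proof.
have [M _ maxM] := @arg_maxP _ _ _ ord0 predT x isT.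
pose P i := [forall j, x j <= x i].
have PM : P M by apply/forallP => j; exact: maxM.
case: (arg_minnP (fun i : 'I_r.+1 => val i) PM) => i0 Pi0 mini0.
have imax0 : is_imax x i0.
  apply/andP; split=> //; apply/forallP => j; apply/implyP => ji0.
  rewrite ltNge; apply/negP => xij; suff /mini0 : P j by rewrite leqNgt ji0.
  by apply/forallP => k; apply: le_trans (forallP Pi0 k) xij.
exists i0; last exact/forallP.
move=> i; apply/idP/eqP => [/andP[Pi /forallP li]|->//].
apply: val_inj; apply/eqP; rewrite eqn_leq (mini0 _ Pi) andbT leqNgt.
apply/negP => /(implyP (li i0)); apply/negP; rewrite -leNgt.
exact: (forallP Pi0).
Qed.

Lemma prod_neq_lift (F : 'I_r.+1 -> R) i0 :
  \prod_(i | i != i0) F i = \prod_q F (lift i0 q).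
Proof.
rewrite (reindex_omap (lift i0) (unlift i0)) => [|i ii0].
  by apply: eq_bigl => q; rewrite liftK eqxx andbT eq_sym neq_lift.
by rewrite eq_sym in ii0; have [q -> ->] := unlift_some ii0.
Qed.

(** Addition is that of the cyclic group ['I_r.+1]; this matches the rotations of an edge in
    [f_le]. *)
Lemma prod_neq_rot (F : 'I_r.+1 -> R) t :
  \prod_(i | i != t) F i = \prod_q F (t + lift ord0 q).
Proof.
rewrite (reindex (+%R t)) /=; last by exists (+%R (- t)) => i _; rewrite ?addKr ?addNKr.
rewrite -(prod_neq_lift (fun i => F (t + i)) ord0); apply: eq_bigl => i.
by rewrite -[X in _ != X]addr0 (inj_eq (addrI t)).
Qed.

(** The two products share all factors outside [i0] and [t], and [x t <= x i0]. *)
Lemma prod_neq_max_le (x : 'I_r.+1 -> R) i0 t :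
  (forall i, 0 <= x i <= x i0) -> \prod_(i | i != i0) x i <= \prod_(i | i != t) x i.
Proof.
move=> xb; have [->//|ti0] := eqVneq t i0.
rewrite (bigD1 t) //= [leRHS](bigD1 i0) 1?eq_sym //=.
rewrite [in leRHS](eq_bigl (fun i => (i != i0) && (i != t))); last first.
  by move=> i; rewrite andbC.
have x0 i : 0 <= x i by case/andP: (xb i).
by apply: ler_pM; rewrite ?prodr_ge0 //; case/andP: (xb t).
Qed.

Section Preference.
Context (m : nat) (P : 'I_r.+1 -> rel 'I_m).

Definition pos i k := #|[pred j | P i j k]|.

Lemma ppointE k i : ppoint P k i = (pos i k)%:R / m%:R :> R.
Proof. by []. Qed.

Context (hP : preference_order P).

Lemma pos_bounds i k : (0 < pos i k <= m)%N.
Proof.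
case: (hP i) => tot _ _; apply/andP; split.
  by apply/card_gt0P; exists k; rewrite inE; have := tot k k; rewrite orbb.
by rewrite -[X in (_ <= X)%N]card_ord max_card.
Qed.

Lemma pos_inj i : injective (pos i).
Proof.
case: (hP i) => tot asym tr.
suff H k k' : P i k k' -> pos i k = pos i k' -> k = k'.
  move=> k k' e; case/orP: (tot k k') => kk'; first exact: H.
  by apply: esym; exact: H.
move=> kk' e; apply: asym; rewrite kk' /=.
have sub : [pred j | P i j k] \subset [pred j | P i j k'].
  by apply/fintype.subsetP => j; rewrite !inE => jk; exact: tr kk'.
have /(_ k') := (subset_cardP e) sub; rewrite !inE => ->.
by have := tot k' k'; rewrite orbb.
Qed.

Lemma packing_of_preference theta : 0 <= theta <= r.+1%:R^-1 -> (0 < m)%N ->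
  exists b : nat, [/\ (r.+1 * b < m)%N, b%:R / m%:R <= theta &
    exists2 G, (0 < G)%N & packing G (b%:R / m%:R) (fP P theta)].
Proof.
move=> /andP[t0 ts] m0.
have mR : 0 < m%:R :> R by rewrite ltr0n.
have exp : exists p, (0 < p)%N && (theta <= p%:R / m%:R).
  exists m; rewrite m0 divff ?gt_eqF //= (le_trans ts) // invf_le1 ?ler1n ?ltr0n //.
(* [p0] is the first position at or above [theta], so [b] counts those below; positions start at 1,
   hence [b = 0] when [theta = 0]. *)
case: (ex_minnP exp) => p0 /andP[p00 tp0] p0min.
pose b := p0.-1; exists b.
have bP p : (0 < p)%N -> (theta <= p%:R / m%:R) = (b < p)%N.
  move=> pp0; apply/idP/idP => [tp|bp].
    by rewrite /b prednK //; apply: p0min; rewrite pp0.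
  by apply: le_trans tp0 _; rewrite ler_pM2r ?invr_gt0 // ler_nat -(prednK p00).
have b_lt : (0 < b)%N -> b%:R / m%:R < theta.
  by move=> b0; rewrite ltNge bP // ltnn.
have bt : b%:R / m%:R <= theta.
  by case: (posnP b) => [->|/b_lt/ltW//]; rewrite mul0r.
have sb : (r.+1 * b < m)%N.
  case: (posnP b) => [->|/b_lt bl]; first by rewrite muln0.
  have := lt_le_trans bl ts; rewrite ltr_pdivrMr // ltr_pdivlMl ?ltr0n //.
  by rewrite -natrM ltr_nat.
split=> //.
pose good := [pred k : 'I_m | [forall i, theta <= ppoint P k i <= (1 : R)]].
have goodP (k : 'I_m) : good k = [forall i, (b < pos i k)%N].
  apply: eq_forallb => i; have /andP[p1 p2] := pos_bounds i k.
  by rewrite ppointE bP // ler_pdivrMr // mul1r ler_nat p2 andbT.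
have /boolp.choice[im imP] : forall k : 'I_m, exists i0 : 'I_r.+1,
    forall i, is_imax (ppoint P k : 'I_r.+1 -> R) i = (i == i0).
  by move=> k; have [i0 H _] := is_imaxP (ppoint P k); exists i0.
have Gm : (m - r.+1 * b <= #|{: {k | good k}}|)%N.
  rewrite card_sig leq_subCl.
  have -> : (m - #|[pred k | good k]| = #|[predC good]|)%N.
    by rewrite -[X in (X - _)%N](card_ord m) -(cardC good) addKn.
  (* An excluded element is encoded by an order [i] placing it among the first [b] and by its
     position there, which makes [r.+1 * b] codes. *)
  pose low (k : 'I_m) : nat := if [pick i | (pos i k <= b)%N] is Some i
    then (b * i + (pos i k).-1)%N else 0%N.
  have lowP k : ~~ good k -> exists i : 'I_r.+1,
      low k = (b * i + (pos i k).-1)%N /\ (pos i k <= b)%N.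
    rewrite goodP negb_forall => /existsP[i]; rewrite -leqNgt => pi.
    by rewrite /low; case: pickP => [i' ?|/(_ i)]; [exists i'|rewrite pi].
  rewrite -[X in (_ <= X)%N]subn0; apply: (@card_le_of_inj _ _ low).
    move=> k k'; rewrite !inE => /lowP[i [-> pi]] /lowP[i' [-> pi']].
    have /andP[p1 _] := pos_bounds i k; have /andP[p1' _] := pos_bounds i' k'.
    move=> /digits_inj[||/val_inj ei]; [lia|lia|].
    by rewrite -ei in p1' pi' * => ep; apply: (@pos_inj i); lia.
  move=> k; rewrite inE => /lowP[i [-> pi]].
  by have := pos_bounds i k; have := ltn_ord i; nia.
have G0 : (0 < #|{: {k | good k}}|)%N by apply: leq_trans Gm; rewrite subn_gt0.
exists #|{: {k | good k}}| => //.
pose delta : R := (r.+1 * m)%:R^-1.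
have d0 : 0 <= delta by rewrite invr_ge0 ler0n.
have sdelta : delta * r.+1%:R = m%:R^-1.
  by rewrite /delta natrM invfM mulrAC mulVf ?mul1r // pnatr_eq0.
have gap : r.+1%:R^-1 - b%:R / m%:R = delta * (m - r.+1 * b)%:R.
  rewrite natrB ?(ltnW sb) // mulrBr; congr (_ - _).
    by rewrite /delta natrM invfM mulfVK ?gt_eqF.
  by rewrite natrM mulrA sdelta mulrC.
clearbody delta.
apply: (@packing_of_entries _ _ _
  (fun x : {k | good k} * 'I_r => ppoint P (val x.1) (lift (im (val x.1)) x.2))).
- by rewrite divr_ge0 ?ler0n //= (le_trans bt).
- move=> [[k gk] q] /=; set i := lift (im k) q.
  have bp : (b < pos i k)%N by have := gk; rewrite goodP => /forallP; exact.
  rewrite gap [leRHS]ppointE.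
  (* Each of the [r.+1] orders contributes at most [pos i k - b] entries with position above [b] and
     at most [pos i k]. As [delta * r.+1] is [1 / m], the bound is exactly [pos i k / m]. *)
  apply: (@le_trans _ _ (b%:R / m%:R + delta * (r.+1 * (pos i k - b))%:R)).
    rewrite lerD2l; apply: step_mul_le => //.
    pose i' (x : {k | good k} * 'I_r) := lift (im (val x.1)) x.2.
    pose p' x := pos (i' x) (val x.1).
    have bp' x : (b < p' x)%N.
      by have := valP x.1; rewrite goodP => /forallP; exact.
    have pp' x : (ppoint P (val x.1) (i' x) <= ppoint P k i :> R) = (p' x <= pos i k)%N.
      by rewrite !ppointE ler_pM2r ?invr_gt0 // ler_nat.
    rewrite -[X in (_ <= X)%N]subn0.
    apply: (@card_le_of_inj _ _ (fun x => (pos i k - b) * i' x + (p' x - b.+1))%N).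
      move=> x y; rewrite !inE -/(i' x) -/(i' y) !pp' => px py.
      have := bp' x; have := bp' y => bx by_.
      move=> /digits_inj[||/val_inj ei ep]; [lia|lia|].
      have {}ep : p' x = p' y by lia.
      have ek : val x.1 = val y.1 by apply: (@pos_inj (i' y)); move: ep; rewrite /p' ei.
      case: x y {px py bx by_ ep} ek ei => [x q1] [y q2] /= /val_inj ->.
      by rewrite /i' /= => /lift_inj ->.
    move=> x; rewrite inE -/(i' x) pp' => px; have := bp' x; have := ltn_ord (i' x).
    by move: (nat_of_ord (i' x)) (p' x) px => y z; nia.
  rewrite natrM mulrA sdelta natrB ?(ltnW bp) // [_^-1 * _]mulrC mulrBl.
  by rewrite addrC subrK.
- move=> [k gk] /=; rewrite -prod_neq_lift /fP.
  rewrite -(eq_bigl _ _ (fun i => congr1 negb (imP k i))).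
  exact: (le_bigmax_cond _ (fun k => \prod_(i | ~~ is_imax (ppoint P k) i) ppoint P k i)).
Qed.

End Preference.

Lemma preference_order_exists m : exists P : 'I_r.+1 -> rel 'I_m, preference_order P.
Proof.
exists (fun _ j k => (j <= k)%N) => i; split.
- by move=> j k; exact: leq_total.
- by move=> j k /anti_leq /val_inj.
- by move=> j k l; exact: leq_trans.
Qed.

Lemma fP_ge0 m (P : 'I_r.+1 -> rel 'I_m) theta : 0 <= fP P theta.
Proof. exact: bigmax_ge_id. Qed.

Lemma h_le_f theta : (0 < r)%N -> 0 <= theta <= r.+1%:R^-1 ->
  h r theta <= f r.+1 theta.
Proof.
move=> r0 tb; case/andP: (tb) => t0 ts.
apply: lb_le_inf; first by exists (fm r.+1 theta 1), 1%N.
move=> _ [m m0 <-]; apply: lb_le_inf.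
  by have [P hP] := preference_order_exists m; exists (fP P theta), P.
move=> _ [P hP <-].
have [b [sb bt [G G0 pk]]] := packing_of_preference hP tb m0.
have b0 : 0 <= b%:R / m%:R :> R by rewrite divr_ge0 ?ler0n.
apply: le_trans (h_nonincreasing r0 b0 bt ts) _.
by apply: h_le_packing pk => //; rewrite b0 (le_trans bt).
Qed.

Lemma f_le theta n B : (0 < n)%N -> packing n 0 B -> f r.+1 theta <= B.
Proof.
move=> n0 [u [ui ul uB]].
have B0 : 0 <= B.
  apply: le_trans (uB (Ordinal n0)); apply: prodr_ge0 => q _.
  by rewrite vtx_ge_theta // invr_ge0 ler0n.
(* The pair [(a, t)] is edge [a] rotated by [t]: its key in order [t] is [r * n + a], above all
   vertex indices, and its other keys are the indices of the edge. *)
pose pt (i : 'I_r.+1) (x : 'I_n * 'I_r.+1) : nat :=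
  if unlift ord0 (i - x.2) is Some q then u x.1 q else (r * n + x.1)%N.
have pti i : injective (pt i).
  move=> [a t] [a' t']; rewrite /pt /=.
  case: unliftP => [q eq|e0]; case: unliftP => [q' eq'|e0'] e.
  - have [-> eqq] := ui (a, q) (a', q') e; congr pair.
    by move: eq; rewrite eqq -eq' => /addrI/oppr_inj.
  - by have := ul a q; rewrite e; lia.
  - by have := ul a' q'; rewrite -e; lia.
  - move/addnI: e => /val_inj ->; congr pair.
    by move: e0; rewrite -e0' => /addrI/oppr_inj.
pose m := #|{: 'I_n * 'I_r.+1}|.
have mE : m = (n * r.+1)%N by rewrite /m card_prod !card_ord.
have m0 : (0 < m)%N by rewrite mE muln_gt0 n0.
pose P (i : 'I_r.+1) : rel 'I_m :=
  fun k l => (pt i (enum_val k) <= pt i (enum_val l))%N.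
have hP : preference_order P.
  move=> i; split.
  - by move=> j k; exact: leq_total.
  - by move=> j k /anti_leq /pti /enum_val_inj.
  - by move=> j k l; exact: leq_trans.
apply: (@le_trans _ _ (fm r.+1 theta m)).
  apply: ge_inf; last by exists m.
  exists 0 => _ [k k0 <-]; apply: lb_le_inf.
    by have [P' hP'] := preference_order_exists k; exists (fP P' theta), P'.
  by move=> _ [P' _ <-]; exact: fP_ge0.
apply: (@le_trans _ _ (fP P theta)).
  apply: ge_inf; last by exists P.
  by exists 0 => _ [P' _ <-]; exact: fP_ge0.
apply: bigmax_le => // k _.
have [i0 imP maxi0] := is_imaxP (ppoint P k).
rewrite (eq_bigl _ _ (fun i => congr1 negb (imP i))).
have x0 i : 0 <= ppoint P k i :> R by rewrite divr_ge0 ?ler0n.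
case ek : (enum_val k) => [a t].
(* Omitting [t] instead of a maximal coordinate can only increase the product. *)
apply: le_trans (@prod_neq_max_le _ _ t _) _; first by move=> i; rewrite x0 maxi0.
rewrite prod_neq_rot; apply: le_trans (uB a); apply: ler_prod => q _.
have -> : vtx 0 n (u a q) = (u a q).+1%:R / m%:R :> R.
  by rewrite /vtx add0r subr0 mE natrM invfM mulrC mulrA.
rewrite x0 /= ppointE ler_wpM2r ?invr_ge0 ?ler0n // ler_nat.
(* Elements placed no later have distinct keys among [0, ..., u a q], so the position is at most
   [(u a q).+1]. *)
rewrite -[X in (_ <= X)%N]subn0.
apply: (@card_le_of_inj _ _ (fun l => pt (t + lift ord0 q) (enum_val l))).
  by move=> l l' _ _ /pti /enum_val_inj.
move=> l; rewrite inE /P ek /= => le; apply: leq_ltn_trans le _.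
by rewrite /pt /= addrAC subrr add0r liftK.
Qed.

End Orders.

Theorem theorem7p10 (R : realType) (r : nat) (hr : (1 <= r)%N) :
  exists phi : R, is_phi r phi /\
    exists c : R, forall theta : R, 0 <= theta <= phi ->
      h r theta = c /\ f r.+1 theta = c.
Proof.
have [phi [phiP hc]] := h_constant (R := R) hr.
exists phi; split=> //; exists (h r 0) => theta tp; split; first exact: hc.
have [/andP[p0 ps] _ _] := phiP; case/andP: (tp) => t0 tle.
have s0 : 0 <= (0 : R) <= r.+1%:R^-1 by rewrite lexx invr_ge0 ler0n.
(* [f] lies between [h r theta] and [h r 0], which agree on [0, phi]. *)
apply/eqP; rewrite eq_le; apply/andP; split.
  apply/ler_addgt0Pr => eps e0; have [n n0] := h_packing hr s0 e0.
  exact: f_le.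
by rewrite -(hc theta tp) h_le_f // t0 (le_trans tle).
Qed.
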